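(* Let $a\ge 0$, $c>-1$, $d\in\mathbb N$ (so $d\ge1$) and let $N\ge1$ be an integer. Then for all nonzero $\zeta,\eta,z,w\in\mathbb C$, $$\mathbf K_{dN}^c(\zeta,\eta)=d\,(\zeta\bar\eta)^{d-1}\sum_{l=0}^{d-1}\widehat{\mathbf K}_N^{\frac{c+l+1}{d}-1}(\zeta^d,\eta^d),$$ $$K_{dN}^c(z,w)=d\,(z\bar w)^{d-1}\sum_{l=0}^{d-1}\widehat K_N^{\frac{c+l+1}{d}-1}(z^d,w^d).$$
   Context: $dA=d^2\zeta/\pi$. $Q(\zeta)=|\zeta-a|^2$ and $V(\zeta)=\frac1d Q(\zeta^d)=\frac1d|\zeta^d-a|^2$. For $c>-1$ and an integer $n\ge1$, $p^c_{j,n}$ and $q^c_{j,n}$ are the orthonormal polynomials of degree $j$ (positive leading coefficient) satisfying $$\int_{\mathbb C}p^c_{j,n}\overline{p^c_{k,n}}\,|\zeta|^{2c}e^{-nQ(\zeta)}dA(\zeta)=\int_{\mathbb C}q^c_{j,n}\overline{q^c_{k,n}}\,|\zeta|^{2c}e^{-nV(\zeta)}dA(\zeta)=\delta_{jk}.$$ The correlation kernels are $$\mathbf K_n^c(\zeta,\eta)=(\zeta\bar\eta)^c e^{-\frac n2(V(\zeta)+V(\eta))}\sum_{j=0}^{n-1}q^c_{j,n}(\zeta)\overline{q^c_{j,n}(\eta)},\qquad \widehat{\mathbf K}_n^c(\zeta,\eta)=(\zeta\bar\eta)^c e^{-\frac n2(Q(\zeta)+Q(\eta))}\sum_{j=0}^{n-1}p^c_{j,n}(\zeta)\overline{p^c_{j,n}(\eta)},$$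 and the rescaled kernels are $$K_n^c(z,w)=\frac1{(n/d)^{1/d}}\mathbf K_n^c\Big(\frac z{(n/d)^{1/(2d)}},\frac w{(n/d)^{1/(2d)}}\Big),\qquad \widehat K_n^c(z,w)=\frac1n\widehat{\mathbf K}_n^c\Big(\frac z{\sqrt n},\frac w{\sqrt n}\Big).$$ Convention on powers: branches are compatible, i.e. when a hatted kernel with exponent $\gamma$ is evaluated at $d$-th powers, $(\zeta^d\bar\eta^d)^\gamma$ is read as $(\zeta\bar\eta)^{d\gamma}$, with the same branch of the power of $\zeta\bar\eta$ on both sides of the identities. *)

(* Defs.v *)
From mathcomp Require Import all_boot all_order all_algebra.
From mathcomp Require Import all_classical all_reals all_analysis.
From mathcomp Require Export complex.

Set Implicit Arguments.
Unset Strict Implicit.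
Unset Printing Implicit Defensive.

Import Order.TTheory GRing.Theory Num.Theory.

Local Open Scope ring_scope.
Local Open Scope complex_scope.

Section Kernels.
Context {R : realType}.
Implicit Types (c : R) (n d : nat) (z w u : R[i]) (W : R[i] -> R).

Definition cmod z : R := ComplexField.Normc.normc z.

(* Integral over the complex plane, identified with R * R, of a complex-valued
   function against the area measure dx dy / pi. *)
Definition integral_dA (f : R[i] -> R[i]) : R[i] :=
  let area := (@lebesgue_measure R \x @lebesgue_measure R)%E in
  pi^-1%:C *
  (Rintegral area setT (fun x => complex.Re (f (x.1 +i* x.2))) +i*
   Rintegral area setT (fun x => complex.Im (f (x.1 +i* x.2)))).

Definition Q (a : R) z : R := cmod (z - a%:C) ^+ 2.

Definition V (d : nat) (a : R) z : R := d%:R^-1 * Q a (z ^+ d).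

Definition weight W c n z : R :=
  cmod z `^ (2 * c) * expR (- (n%:R * W z)).

(* In R[i], 0 < z means that z is real and positive. *)
Definition orthonormal_polynomials W c n (p : nat -> {poly R[i]}) : Prop :=
  (forall j : nat, size (p j) = j.+1 /\ 0 < lead_coef (p j)) /\
  (forall j k : nat,
     integral_dA (fun z => (p j).[z] * ((p k).[z])^* * (weight W c n z)%:C)
     = (j == k)%:R).

(* A branch of the powers of u <> 0 is given by an argument t of u (i.e. by the
   logarithm ln |u| + i t); cpow t u s is the value of u^s in that branch. *)
Definition is_arg (t : R) u : Prop := u = (cmod u)%:C * (cos t +i* sin t).

Definition cpow (t : R) u (s : R) : R[i] :=
  (cmod u `^ s)%:C * (cos (s * t) +i* sin (s * t)).

(* t is the argument of z * w^* selecting the branch of (z * w^* )^c. *)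
Definition corr_kernel W c n (p : nat -> {poly R[i]}) (t : R) z w : R[i] :=
  cpow t (z * w^*) c * (expR (- (n%:R / 2 * (W z + W w))))%:C *
  \sum_(j < n) (p j).[z] * ((p j).[w])^*.

(* The argument t of z * w^* is also one of the product of the rescaled points,
   since the scaling factors are positive reals. *)
Definition rescaled_corr_kernelV (d : nat) (a : R) c n (q : nat -> {poly R[i]})
    (t : R) z w : R[i] :=
  let r : R := (n%:R / d%:R) `^ (2 * d%:R)^-1 in
  (((n%:R / d%:R) `^ d%:R^-1)^-1)%:C *
  corr_kernel (V d a) c n q t (z / r%:C) (w / r%:C).

Definition rescaled_corr_kernelQ (a : R) c n (p : nat -> {poly R[i]})
    (t : R) z w : R[i] :=
  let r : R := Num.sqrt n%:R in
  (n%:R^-1)%:C * corr_kernel (Q a) c n p t (z / r%:C) (w / r%:C).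

Lemma cos_sin_expn (t : R) n :
  (cos t +i* sin t) ^+ n = cos (n%:R * t) +i* sin (n%:R * t).
Proof.
elim: n => [|n IHn]; first by rewrite expr0 mul0r cos0 sin0.
rewrite exprS IHn -natr1 mulrDl mul1r (addrC _ t) cosD sinD.
by apply/eqP; rewrite eq_complex /= eqxx addrC (mulrC (cos t)) (mulrC (sin t))
  mulrC eqxx.
Qed.

Lemma cmodX u n : cmod (u ^+ n) = cmod u ^+ n.
Proof.
elim: n => [|n IHn]; first by rewrite !expr0 /cmod ComplexField.Normc.normc1.
by rewrite !exprS {1}/cmod ComplexField.Normc.normcM -IHn.
Qed.

Lemma is_argX t u n : is_arg t u -> is_arg (n%:R * t) (u ^+ n).
Proof.
move=> h; rewrite /is_arg cmodX -cos_sin_expn.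
by rewrite [in LHS]h exprMn rmorphXn.
Qed.

(* When t is an argument of u, the value of (u^n)^s in the branch with argument
   n * t is the value of u^(n * s) in the branch with argument t. *)
Lemma cpowX t u n s : cpow (n%:R * t) (u ^+ n) s = cpow t u (n%:R * s).
Proof.
by rewrite /cpow cmodX -powR_mulrn ?powRrM ?(mulrC n%:R s) ?mulrA // /cmod;
  case: u => x y; exact: sqrtr_ge0.
Qed.

Lemma cpow_nat t u n : is_arg t u -> cpow t u n%:R = u ^+ n.
Proof.
move=> h; rewrite [in RHS]h exprMn cos_sin_expn /cpow powR_mulrn ?rmorphXn //.
by rewrite /cmod; case: (u) => x y; exact: sqrtr_ge0.
Qed.

End Kernels.

(* Main.v *)
From HB Require Import structures.
Require Import Defs.
From mathcomp Require Import all_boot all_order all_algebra.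
From mathcomp Require Import all_classical all_reals all_analysis.
From mathcomp Require Import measurable_realfun complex ring lra.
Import Order.TTheory GRing.Theory Num.Theory.
Local Open Scope ring_scope.
Local Open Scope complex_scope.

(** Why the identity holds.  The potential V depends on z only through z ^+ d,
    and d N V(z) = N Q(z ^+ d), so the weight of the left-hand kernel is, apart
    from a power of |z|, the pull-back of the Gaussian weight by z |-> z ^+ d.
    Write m = d j + l with 0 <= l < d and let p^l_j be the orthonormal
    polynomials for the exponent gamma_l = (c + l + 1) / d - 1.  The polynomials

      r_m(z) = sqrt d * z ^+ l * p^l_j(z ^+ d)

    have degree m, positive leading coefficient, and are orthonormal for the
    weight |z|^(2c) exp(- d N V(z)):
    - if l <> l', the substitution z |-> w z with w a primitive d-th root of
      unity preserves the weight and multiplies r_m * conj r_m' by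
      w^(l - l') <> 1, so that the product vanishes
      ([wprod_power_family_neq]);
    - if l = l', then 2 c + 2 l = 2 (d - 1) + 2 d gamma_l, and the change of
      variables z |-> z ^+ d, whose Jacobian is d^2 |z|^(2(d-1)) and which is
      d-to-one, gives back the product of p^l_j and p^l_j'
      ([wprod_power_family_eq]).
    Orthonormal polynomials are unique ([orthonormal_family_unique]), hence
    q_m = r_m; grouping the sum over m by residues mod d gives the first
    identity ([corr_kernel_power_family]), and rescaling gives the second one.

    The change of variables [ge0_integral_pow] is the analytic core.  It is
    obtained from invariance rather than from derivatives.  Lebesgue measure is
    multiplied by |u|^2 under z |-> u z, by shears and Tonelli
    ([ge0_integral_cmul]); so |z|^-2 dz is a Haar measure of the multiplicative
    group C^*.  The power map is a surjective endomorphism of C^*, so the image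
    of the Haar measure is again invariant, hence proportional to it; the
    factor 1/d is found by cutting an annulus into d dilated copies of a
    smaller one ([haar_pow]).

    Integrability comes from the normalisation: a diagonal product equal to 1
    forces the corresponding integral to be finite ([sq_integrable_unit]), and
    from there all products of polynomials are integrable, by
    |f g| <= |f|^2 + |g|^2. *)

Set Implicit Arguments.
Unset Strict Implicit.
Unset Printing Implicit Defensive.

(* Keeps the modulus folded when simplification meets an explicit a +i* b. *)
Arguments cmod : simpl never.

(** * Linear substitutions in the plane *)

Section PlaneMeasure.
Local Open Scope classical_set_scope.
(* Opened last, so that z^* always stands for Num.conj z and not conjc z. *)
Local Open Scope ring_scope.
Context {R : realType}.
Local Notation leb := (@lebesgue_measure R).

(** Uniqueness of Lebesgue measure reduces this to half-open intervals. *)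
Lemma lebesgue_measure_affine (k b : R) (A : set (measurableTypeR R)) :
  k != 0 -> measurable A ->
  leb A = (`|k|%:E * leb ((fun y : R => (k * y + b)%R) @^-1` A))%E.
Proof.
move=> k0 mA.
pose phi := (fun y : measurableTypeR R => k * y + b : measurableTypeR R).
have mphi : measurable_fun setT phi.
  by apply: measurable_funD => //; exact: mulrl_measurable.
pose nu := mscale (NngNum (normr_ge0 k)) (pushforward leb phi).
rewrite (@lebesgue_measure_unique R (nu mphi)) //= => _ [[a c]] _ <-.
rewrite /nu /mscale /= /pushforward lebesgue_measure_itv /=.
have [kp|kn] := ltP 0 k.
  have -> : phi @^-1` `]a, c]%classic = `](a - b) / k, (c - b) / k]%classic.
    apply/seteqP; split => x /=; rewrite /phi !in_itv/= ltr_pdivrMr// ler_pdivlMr//;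
      rewrite ltrBlDr lerBrDr (mulrC x) => -> //.
  rewrite lebesgue_measure_itv /= !lte_fin ltr_pM2r ?invr_gt0// ltrD2r.
  case: ifP => _; rewrite ?mule0// -EFinM gtr0_norm//; congr EFin; field.
  by rewrite gt_eqF.
have {k0}kn : k < 0 by rewrite lt_neqAle k0.
have -> : phi @^-1` `]a, c]%classic = `[(c - b) / k, (a - b) / k[%classic.
  apply/seteqP; split => x /=; rewrite /phi !in_itv/= ltr_ndivlMr// ler_ndivrMr//;
      rewrite ltrBlDr lerBrDr (mulrC x) andbC => -> //.
rewrite lebesgue_measure_itv /= !lte_fin ltr_nM2r ?invr_lt0// ltrD2r.
case: ifP => _; rewrite ?mule0// -EFinM ltr0_norm//; congr EFin; field.
by rewrite lt_eqF.
Qed.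

Lemma ge0_integral_affine (k b : R) (h : measurableTypeR R -> \bar R) :
  k != 0 -> measurable_fun setT h -> (forall y, 0 <= h y)%E ->
  (\int[leb]_y h y = `|k|%:E * \int[leb]_y h (k * y + b)%R)%E.
Proof.
move=> k0 mh h0.
pose phi := (fun y : measurableTypeR R => k * y + b : measurableTypeR R).
have mphi : measurable_fun setT phi.
  by apply: measurable_funD => //; exact: mulrl_measurable.
pose nu := mscale (NngNum (normr_ge0 k)) (pushforward leb phi).
rewrite (@eq_measure_integral _ _ _ _ (nu mphi)); last first.
  move=> A mA _ /=.
  exact: lebesgue_measure_affine.
rewrite ge0_integral_mscale//=; congr (_ * _)%E.
by rewrite ge0_integral_pushforward.
Qed.

Local Notation RR := (measurableTypeR R).
Local Notation plane := (RR * RR)%type.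

(** Named, so that it carries the sigma-finiteness proved below, which Tonelli
    needs on products of two planes. *)
Definition area : set plane -> \bar R := (leb \x leb)%E.

HB.instance Definition _ := Measure.on area.

Lemma area_sigma_finite : sigma_finite setT area.
Proof.
have /sigma_finiteP[F [TF ndF Foo]] := @sigma_finiteT _ _ _ leb.
exists (fun n => F n `*` F n).
 rewrite -setXTT TF predeqE => -[x y]; split.
    move=> [/= [n _ Fnx] [k _ Gky]]; exists (maxn n k) => //; split.
    - by move: x Fnx; exact/subsetPset/ndF/leq_maxl.
    - by move: y Gky; exact/subsetPset/ndF/leq_maxr.
  by move=> [n _ []/= ? ?]; split; exists n.
move=> k; have [? ?] := Foo k.
split; first exact: measurableX.
by rewrite /area product_measure1E// lte_mul_pinfty// ge0_fin_numE.
Qed.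

HB.instance Definition _ :=
  @Measure_isSigmaFinite.Build _ plane R area area_sigma_finite.

(** On each vertical line this is an affine substitution, so Tonelli
    applies. *)
Lemma ge0_integral_shear_snd (k c : R) (H : plane -> \bar R) :
  k != 0 -> measurable_fun setT H -> (forall x, 0 <= H x)%E ->
  (\int[area]_x H x = `|k|%:E * \int[area]_x H (x.1, k * x.2 + c * x.1)%R)%E.
Proof.
move=> k0 mH H0.
have mK : measurable_fun setT (fun x : plane => H (x.1, k * x.2 + c * x.1)).
  apply: measurableT_comp => //; apply: measurable_fun_pair => //.
  by apply: measurable_funD; apply: measurable_funM.
rewrite /area !fubini_tonelli1// -ge0_integralZl//; first last.
- by move=> x _; exact: integral_ge0.
- exact: measurable_fun_fubini_tonelli_F.
apply: eq_integral => x _; rewrite /fubini_F/=.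
rewrite (@ge0_integral_affine k (c * x) (fun y => H (x, y)))//.
exact: measurableT_comp.
Qed.

Lemma ge0_integral_shear_fst (k c : R) (H : plane -> \bar R) :
  k != 0 -> measurable_fun setT H -> (forall x, 0 <= H x)%E ->
  (\int[area]_x H x = `|k|%:E * \int[area]_x H (k * x.1 + c * x.2, x.2)%R)%E.
Proof.
move=> k0 mH H0.
have mK : measurable_fun setT (fun x : plane => H (k * x.1 + c * x.2, x.2)).
  apply: measurableT_comp => //; apply: measurable_fun_pair => //.
  by apply: measurable_funD; apply: measurable_funM.
rewrite /area !fubini_tonelli2// -ge0_integralZl//; first last.
- by move=> x _; exact: integral_ge0.
- exact: measurable_fun_fubini_tonelli_G.
apply: eq_integral => y _; rewrite /fubini_G/=.
rewrite (@ge0_integral_affine k (c * y) (fun x => H (x, y)))//.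
exact: measurableT_comp.
Qed.

(** * Measurability of complex-valued functions *)

(** The identification of R * R with the complex plane that [integral_dA]
    uses. *)
Definition toC (x : plane) : R[i] := x.1 +i* x.2.

(** Measurability for the Borel structure of the plane, in coordinates. *)
Definition cmeasurable d (T : measurableType d) (g : T -> R[i]) :=
  measurable_fun setT (fun x => complex.Re (g x) : RR) /\
  measurable_fun setT (fun x => complex.Im (g x) : RR).

(** Reduces measurability on an arbitrary source, such as the product of two
    planes, to measurability on the plane. *)
Lemma cmeasurable_comp d (T : measurableType d) d' (T' : measurableType d')
    (F : R[i] -> T') (g : T -> R[i]) :
  measurable_fun setT (F \o toC) -> cmeasurable g ->
  measurable_fun setT (fun x => F (g x)).
Proof.
move=> mF [mr mi].
have -> : (fun x => F (g x)) = (F \o toC) \o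
    (fun x => (complex.Re (g x), complex.Im (g x))).
  by apply/funext => x /=; rewrite /toC/=; case: (g x).
by apply: measurableT_comp => //; exact: measurable_fun_pair.
Qed.

Lemma cmeasurable_ccomp d (T : measurableType d) (F : R[i] -> R[i]) (g : T -> R[i]) :
  cmeasurable (fun x : plane => F (toC x)) -> cmeasurable g ->
  cmeasurable (fun x => F (g x)).
Proof.
move=> [mr mi] mg; split.
  exact: (@cmeasurable_comp _ _ _ RR (fun z => complex.Re (F z))).
exact: (@cmeasurable_comp _ _ _ RR (fun z => complex.Im (F z))).
Qed.

Lemma cmeasurable_toC : cmeasurable toC.
Proof. by split; [exact: measurable_fst|exact: measurable_snd]. Qed.

Lemma cmeasurable_cst d (T : measurableType d) (a : R[i]) :
  cmeasurable (fun _ : T => a).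
Proof. by split; exact: measurable_cst. Qed.

Lemma cmeasurable_real d (T : measurableType d) (f : T -> R) :
  measurable_fun setT (f : T -> RR) -> cmeasurable (fun x => (f x)%:C).
Proof. by split => //; exact: measurable_cst. Qed.

Lemma cmeasurableM d (T : measurableType d) (f g : T -> R[i]) :
  cmeasurable f -> cmeasurable g -> cmeasurable (fun x => f x * g x).
Proof.
move=> [fr fi] [gr gi]; split.
  rewrite (_ : (fun _ => _) = (fun x => complex.Re (f x) * complex.Re (g x)
     - complex.Im (f x) * complex.Im (g x))).
    by apply: measurable_funB; exact: measurable_funM.
  by apply/funext => x; case: (f x) (g x) => [? ?] [? ?].
rewrite (_ : (fun _ => _) = (fun x => complex.Re (f x) * complex.Im (g x)
     + complex.Im (f x) * complex.Re (g x))).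
  by apply: measurable_funD; exact: measurable_funM.
by apply/funext => x; case: (f x) (g x) => [? ?] [? ?].
Qed.

Lemma cmeasurableD d (T : measurableType d) (f g : T -> R[i]) :
  cmeasurable f -> cmeasurable g -> cmeasurable (fun x => f x + g x).
Proof.
move=> [fr fi] [gr gi]; split.
  rewrite (_ : (fun _ => _) = (fun x => complex.Re (f x) + complex.Re (g x))).
    exact: measurable_funD.
  by apply/funext => x; case: (f x) (g x) => [? ?] [? ?].
rewrite (_ : (fun _ => _) = (fun x => complex.Im (f x) + complex.Im (g x))).
  exact: measurable_funD.
by apply/funext => x; case: (f x) (g x) => [? ?] [? ?].
Qed.

Lemma conj_ReIm (z : R[i]) : z^* = complex.Re z -i* complex.Im z.
Proof. by case: z. Qed.

Lemma cmeasurable_conj d (T : measurableType d) (f : T -> R[i]) :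
  cmeasurable f -> cmeasurable (fun x => (f x)^*).
Proof.
move=> [fr fi]; split.
  rewrite (_ : (fun _ => _) = (fun x => complex.Re (f x)))//.
  by apply/funext => x; case: (f x).
rewrite (_ : (fun _ => _) = (fun x => - complex.Im (f x))).
  exact: measurableT_comp.
by apply/funext => x; case: (f x).
Qed.

Lemma cmeasurableX d (T : measurableType d) (f : T -> R[i]) n :
  cmeasurable f -> cmeasurable (fun x => f x ^+ n).
Proof.
move=> mf; elim: n => [|n IHn]; first exact: cmeasurable_cst.
rewrite (_ : (fun _ => _) = (fun x => f x * f x ^+ n)); first exact: cmeasurableM.
by apply/funext => x; rewrite exprS.
Qed.

Lemma cmeasurable_horner d (T : measurableType d) (f : T -> R[i]) (p : {poly R[i]}) :
  cmeasurable f -> cmeasurable (fun x => p.[f x]).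
Proof.
move=> mf; elim/poly_ind: p => [|p a IHp].
  rewrite (_ : (fun _ => _) = (fun=> 0)); first exact: cmeasurable_cst.
  by apply/funext => x; rewrite horner0.
rewrite (_ : (fun _ => _) = (fun x => p.[f x] * f x + a)).
  by apply: cmeasurableD; [exact: cmeasurableM|exact: cmeasurable_cst].
by apply/funext => x; rewrite hornerMXaddC.
Qed.

(** * The modulus, and multiplication by a complex number *)

Lemma cmodE (z : R[i]) : cmod z = Num.sqrt (complex.Re z ^+ 2 + complex.Im z ^+ 2).
Proof. by case: z. Qed.

Lemma cmod_ge0 (z : R[i]) : 0 <= cmod z.
Proof. by rewrite cmodE sqrtr_ge0. Qed.

Lemma cmodM (z w : R[i]) : cmod (z * w) = cmod z * cmod w.
Proof. exact: ComplexField.Normc.normcM. Qed.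

Lemma cmodV (z : R[i]) : cmod z^-1 = (cmod z)^-1.
Proof. exact: ComplexField.Normc.normcV. Qed.

Lemma cmod_eq0 (z : R[i]) : (cmod z == 0) = (z == 0).
Proof.
apply/eqP/eqP => [|->]; first exact: ComplexField.Normc.eq0_normc.
exact: ComplexField.Normc.normc0.
Qed.

Lemma cmod_gt0 (z : R[i]) : (0 < cmod z) = (z != 0).
Proof. by rewrite lt_neqAle cmod_ge0 andbT eq_sym cmod_eq0. Qed.

Lemma sqr_cmod (z : R[i]) : cmod z ^+ 2 = complex.Re z ^+ 2 + complex.Im z ^+ 2.
Proof. by rewrite cmodE sqr_sqrtr// addr_ge0 ?sqr_ge0. Qed.

Lemma measurable_cmod d (T : measurableType d) (f : T -> R[i]) :
  cmeasurable f -> measurable_fun setT (fun x => cmod (f x) : RR).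
Proof.
move=> [mr mi]; rewrite (_ : (fun _ => _) =
  (fun x => (complex.Re (f x) ^+ 2 + complex.Im (f x) ^+ 2) `^ (2^-1))).
  apply: (measurableT_comp (measurable_powR _)).
  by apply: measurable_funD; exact: measurable_funX.
by apply/funext => x; rewrite powR12_sqrt ?cmodE// addr_ge0 ?sqr_ge0.
Qed.

(** When Re u <> 0, multiplication by u is the product of a horizontal and a
    vertical shear, with dilation factors whose product is |u|^2.  A purely
    imaginary u is the product of 1 + i and u / (1 + i), which both have a
    nonzero real part. *)
Lemma ge0_integral_cmul (u : R[i]) (F : R[i] -> \bar R) :
  u != 0 -> measurable_fun setT (F \o toC) -> (forall z, 0 <= F z)%E ->
  (\int[area]_x F (toC x) =
   (cmod u ^+ 2)%:E * \int[area]_x F (u * toC x)%R)%E.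
Proof.
have main v (G : R[i] -> \bar R) : complex.Re v != 0 ->
    measurable_fun setT (G \o toC) -> (forall z, 0 <= G z)%E ->
    (\int[area]_x G (toC x) =
     (cmod v ^+ 2)%:E * \int[area]_x G (v * toC x)%R)%E.
  case: v => [a b] /= a0 mG G0.
  have n0 : a ^+ 2 + b ^+ 2 != 0.
    by rewrite gt_eqF// ltr_wpDr ?sqr_ge0// exprn_even_gt0.
  pose H := fun x : plane => G (toC ((a ^+ 2 + b ^+ 2) / a * x.1 + - b / a * x.2, x.2)).
  have mH : measurable_fun setT H.
    apply: (measurableT_comp mG); apply: measurable_fun_pair => //.
    by apply: measurable_funD; apply: measurable_funM.
  rewrite (@ge0_integral_shear_fst ((a ^+ 2 + b ^+ 2) / a) (- b / a)
    (fun x => G (toC x)))//; last by rewrite mulf_neq0// invr_neq0.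
  rewrite (@ge0_integral_shear_snd a b H)//; last by move=> x; exact: G0.
  rewrite muleA -EFinM sqr_cmod/= -normrM divfK// ger0_norm ?addr_ge0 ?sqr_ge0//.
  congr (_ * _)%E; apply: eq_integral => -[x y] _; rewrite /H/toC/=.
  congr G; apply/eqP; rewrite eq_complex /=; apply/andP; split; apply/eqP.
    by field.
  by rewrite addrC.
move=> u0 mF F0; have [ur0|ur0] := eqVneq (complex.Re u) 0; last exact: main.
pose v : R[i] := 1 +i* 1; pose w := u / v.
have v0 : v != 0 by rewrite eq_complex /= oner_eq0.
have uE : u = v * w by rewrite /w mulrC divfK.
have v1 : complex.Re v != 0 by rewrite oner_eq0.
rewrite (main v)//.
rewrite (main w (fun z => F (v * z))) //=.
- rewrite muleA -EFinM uE cmodM exprMn; congr (_ * _)%E.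
  by apply: eq_integral => x _; rewrite mulrA.
- rewrite /w /v; move: ur0 u0 {uE}; case: u @w => [a b] w /= ->.
  rewrite eq_complex /= eqxx /= => b0; rewrite !mul0r !mul1r sub0r mulrN opprK.
  rewrite mulf_neq0// expr1n invr_neq0//.
- apply: (cmeasurable_comp mF); apply: cmeasurableM; first exact: cmeasurable_cst.
  exact: cmeasurable_toC.
Qed.

End PlaneMeasure.

(** * Haar measure of the multiplicative group of the complex numbers *)

Section Haar.
Local Open Scope classical_set_scope.
Local Open Scope ring_scope.
Context {R : realType}.
Local Notation leb := (@lebesgue_measure R).
Local Notation area := (@area R).
Local Notation RR := (measurableTypeR R).
Local Notation plane := (RR * RR)%type.

Lemma cmeasurableV d (T : measurableType d) (f : T -> R[i]) :
  cmeasurable f -> cmeasurable (fun x => (f x)^-1).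
Proof.
move=> mf; have [fr fi] := mf.
have mn : measurable_fun setT (fun x => (cmod (f x) ^+ 2) `^ (-1) : RR).
  apply: (measurableT_comp (measurable_powR _)); apply: measurable_funX.
  exact: measurable_cmod.
split.
  rewrite (_ : (fun _ => _) =
      (fun x => complex.Re (f x) * (cmod (f x) ^+ 2) `^ (-1))).
    exact: measurable_funM.
  by apply/funext => x; rewrite powR_inv1 ?sqr_ge0// sqr_cmod; case: (f x).
rewrite (_ : (fun _ => _) =
    (fun x => - (complex.Im (f x) * (cmod (f x) ^+ 2) `^ (-1)))).
  by apply: measurableT_comp => //; exact: measurable_funM.
by apply/funext => x; rewrite powR_inv1 ?sqr_ge0// sqr_cmod; case: (f x).
Qed.

(** The density |z|^-2 of Haar measure on C^*; the convention 0^-1 = 0 makes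
    it vanish at the origin, where the group law degenerates. *)
Definition haar_density (z : R[i]) : \bar R := (cmod z ^- 2)%:E.

Lemma haar_density_ge0 z : (0 <= haar_density z)%E.
Proof. by rewrite lee_fin invr_ge0 exprn_ge0// cmod_ge0. Qed.

Lemma haar_density0 : haar_density 0 = 0%E.
Proof.
have /eqP c0 : cmod (0 : R[i]) == 0 by rewrite cmod_eq0.
by rewrite /haar_density c0 expr0n/= invr0.
Qed.

Lemma measurable_haar_density d (T : measurableType d) (f : T -> R[i]) :
  cmeasurable f -> measurable_fun setT (fun x => haar_density (f x)).
Proof.
move=> mf; apply/measurable_EFinP.
rewrite (_ : (fun _ => _) = (fun x => (cmod (f x)^-1) ^+ 2)).
  by apply: measurable_funX; apply: measurable_cmod; exact: cmeasurableV.
by apply/funext => x; rewrite /= cmodV exprVn.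
Qed.

Definition haar (F : R[i] -> \bar R) : \bar R :=
  (\int[area]_x (haar_density (toC x) * F (toC x)))%E.

Lemma haar_ge0 F : (forall z, 0 <= F z)%E -> (0 <= haar F)%E.
Proof.
by move=> F0; apply: integral_ge0 => x _; rewrite mule_ge0// haar_density_ge0.
Qed.

Lemma haar_mul (u : R[i]) (F : R[i] -> \bar R) :
  u != 0 -> measurable_fun setT (F \o toC) -> (forall z, 0 <= F z)%E ->
  haar (fun z => F (u * z)) = haar F.
Proof.
move=> u0 mF F0; rewrite /haar.
have m1 : cmeasurable (fun x : plane => u * toC x).
  by apply: cmeasurableM; [exact: cmeasurable_cst|exact: cmeasurable_toC].
have m2 : measurable_fun setT
    ((fun z => (haar_density z * F z)%E) \o toC).
  by apply: emeasurable_funM => //; apply: measurable_haar_density;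
    exact: cmeasurable_toC.
rewrite [RHS](@ge0_integral_cmul _ u (fun z => haar_density z * F z)%E)//; last first.
  by move=> z; rewrite mule_ge0// haar_density_ge0.
rewrite -ge0_integralZl//; first last.
- by rewrite lee_fin sqr_ge0.
- by move=> x _; rewrite mule_ge0// haar_density_ge0.
- exact: (cmeasurable_comp m2).
apply: eq_integral => x _; rewrite muleA; congr (_ * _)%E.
rewrite /haar_density -EFinM; congr EFin; rewrite cmodM exprMn [in RHS]invfM mulVKf//.
by rewrite expf_neq0// cmod_eq0.
Qed.

Lemma complex_root n (z : R[i]) : (0 < n)%N -> exists v : R[i], v ^+ n = z.
Proof.
move=> n0; exists (n.-root z); exact: rootCK.
Qed.

Lemma haarZl (k : \bar R) F : (0 <= k)%E -> measurable_fun setT (F \o toC) ->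
  (forall z, 0 <= F z)%E -> haar (fun z => k * F z)%E = (k * haar F)%E.
Proof.
move=> k0 mF F0; rewrite /haar -ge0_integralZl//.
- by apply: eq_integral => x _; rewrite muleCA.
- by apply: emeasurable_funM => //; apply: measurable_haar_density;
    exact: cmeasurable_toC.
- by move=> x _; rewrite mule_ge0// haar_density_ge0.
Qed.

(** The proof of uniqueness of Haar measure, for the Haar measure and its
    image under the power map: integrate f(x) g(x z^d) over both variables.
    Invariance in z removes x from g (every x is a d-th power) and gives the
    left-hand side; the substitution x -> x z^-d followed by invariance in z
    gives the right-hand side. *)
Lemma haar_pow_swap (d : nat) (f g : R[i] -> \bar R) : (0 < d)%N ->
  measurable_fun setT (f \o toC) -> (forall z, 0 <= f z)%E ->
  measurable_fun setT (g \o toC) -> (forall z, 0 <= g z)%E ->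
  (haar f * haar (fun z => g (z ^+ d)%R) =
   haar g * haar (fun z => f (z^-1 ^+ d)%R))%E.
Proof.
move=> d0 mf f0 mg g0.
have mC := @cmeasurable_toC R.
have m1 : cmeasurable (fun x : plane * plane => toC x.1).
  by have [a b] := mC; split; [exact: (measurableT_comp a)|exact: (measurableT_comp b)].
have m2 : cmeasurable (fun x : plane * plane => toC x.2).
  by have [a b] := mC; split; [exact: (measurableT_comp a)|exact: (measurableT_comp b)].
have mX (h : R[i] -> \bar R) k : measurable_fun setT (h \o toC) ->
    measurable_fun setT ((fun z => h (z ^+ k)) \o toC).
  by move=> mh; apply: (cmeasurable_comp mh); exact: cmeasurableX.
have pow0 v x : toC x != 0 -> v ^+ d = toC x -> v != 0.
  by move=> x0 vx; apply: contraNneq x0 => v0; rewrite -vx v0 expr0n gtn_eqF.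
pose K := fun x : plane * plane =>
  (haar_density (toC x.1) * f (toC x.1) *
   (haar_density (toC x.2) * g (toC x.1 * toC x.2 ^+ d)%R))%E.
have K0 x : (0 <= K x)%E by rewrite /K !mule_ge0// haar_density_ge0.
have mK : measurable_fun setT K.
  apply: emeasurable_funM; apply: emeasurable_funM;
    [exact: measurable_haar_density|exact: (cmeasurable_comp mf)
    |exact: measurable_haar_density|].
  by apply: (cmeasurable_comp mg); apply: cmeasurableM => //; exact: cmeasurableX.
transitivity (\int[area]_x \int[area]_z K (x, z))%E.
  rewrite muleC [haar f]/haar -ge0_integralZl//; first last.
  - exact: haar_ge0.
  - by move=> x _; rewrite mule_ge0// haar_density_ge0.
  - by apply: emeasurable_funM => //; exact: measurable_haar_density.
  apply: eq_integral => x _; rewrite /K/=.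
  rewrite ge0_integralZl//; first last.
  - by rewrite mule_ge0// haar_density_ge0.
  - by move=> z _; rewrite mule_ge0// haar_density_ge0.
  - apply: emeasurable_funM; first exact: measurable_haar_density.
    apply: (cmeasurable_comp mg); apply: cmeasurableM; first exact: cmeasurable_cst.
    exact: cmeasurableX.
  have [->|x0] := eqVneq (toC x) 0; first by rewrite haar_density0 !mul0e mule0.
  have [v vx] := complex_root (toC x) d0.
  rewrite muleC; congr (_ * _)%E; rewrite -(@haar_mul v); first last.
  - by move=> z; exact: g0.
  - exact: mX.
  - exact: pow0 vx.
  by apply: eq_integral => z _; rewrite exprMn vx.
rewrite (fubini_tonelli K)//.
pose H z x := (f (x * z^-1 ^+ d)%R * g x)%E.
have H0 z x : (0 <= H z x)%E by rewrite mule_ge0.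
have mH z : measurable_fun setT (H z \o toC).
  apply: emeasurable_funM => //; apply: (cmeasurable_comp mf).
  by apply: cmeasurableM => //; exact: cmeasurable_cst.
transitivity (\int[area]_z (haar_density (toC z) * haar (H (toC z))))%E.
  apply: eq_integral => z _.
  have [z0|z0] := eqVneq (toC z) 0.
    rewrite z0 haar_density0 mul0e integral0_eq// => x _.
    by rewrite /K/= z0 haar_density0 mul0e mule0.
  rewrite -(@haar_mul (toC z ^+ d))//; last by rewrite expf_neq0.
  rewrite -haarZl ?haar_density_ge0//; first last.
    apply: (cmeasurable_comp (mH (toC z))).
    by apply: cmeasurableM => //; exact: cmeasurable_cst.
  apply: eq_integral => x _; rewrite /K/H/= -muleA; congr (_ * _)%E.
  rewrite muleCA; congr (_ * (f _ * g _))%E; last by rewrite mulrC.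
  by rewrite exprVn mulrAC divff ?mul1r// expf_neq0.
pose L := fun x : plane * plane =>
  (haar_density (toC x.1) * (haar_density (toC x.2) * H (toC x.1) (toC x.2)))%E.
have L0 x : (0 <= L x)%E by rewrite /L !mule_ge0// haar_density_ge0.
have mL : measurable_fun setT L.
  do 2 (apply: emeasurable_funM; first exact: measurable_haar_density).
  apply: emeasurable_funM; last exact: (cmeasurable_comp mg).
  apply: (cmeasurable_comp mf); apply: cmeasurableM => //.
  by apply: cmeasurableX; exact: cmeasurableV.
transitivity (\int[area]_z \int[area]_x L (z, x))%E.
  apply: eq_integral => z _; rewrite -haarZl ?haar_density_ge0//.
  by apply: eq_integral => x _; rewrite /L/= muleCA.
rewrite (fubini_tonelli L)//.
rewrite muleC {2}/haar -ge0_integralZl//; first last.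
- by apply: haar_ge0 => z; exact: f0.
- by move=> x _; rewrite mule_ge0// haar_density_ge0.
- by apply: emeasurable_funM => //; exact: measurable_haar_density.
apply: eq_integral => x _; rewrite /L/=.
have [x0|x0] := eqVneq (toC x) 0.
  rewrite x0 haar_density0 mul0e mule0 integral0_eq// => z _.
  by rewrite mul0e mule0.
have [v vx] := complex_root (toC x) d0.
rewrite -(@haar_mul v^-1); first last.
- by move=> z; exact: f0.
- by apply: (cmeasurable_comp mf); apply: cmeasurableX; exact: cmeasurableV.
- by rewrite invr_neq0//; exact: pow0 vx.
rewrite muleC -haarZl; first last.
- by move=> z; exact: f0.
- apply: (cmeasurable_comp mf); apply: cmeasurableX; apply: cmeasurableV.
  by apply: cmeasurableM => //; exact: cmeasurable_cst.
- by rewrite mule_ge0// haar_density_ge0.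
apply: eq_integral => z _; congr (_ * _)%E; rewrite -muleA; congr (_ * _)%E.
by rewrite /H muleC; congr (_ * f _)%E; rewrite -vx -exprMn invfM invrK.
Qed.

(** * The image of the Haar measure under a power map *)

Definition annulus (s t : R) (z : R[i]) : \bar R :=
  (\1_(`[s, t[%classic : set RR) (cmod z))%:E.

Lemma annulus_ge0 s t z : (0 <= annulus s t z)%E.
Proof. by rewrite lee_fin. Qed.

Lemma measurable_annulus s t : measurable_fun setT (annulus s t \o toC).
Proof.
apply/measurable_EFinP; apply: measurableT_comp.
  exact: measurable_indic.
by apply: measurable_cmod; exact: cmeasurable_toC.
Qed.

Lemma haar_annulus_scale k s t : 0 < k ->
  haar (annulus (k * s) (k * t)) = haar (annulus s t).
Proof.
move=> k0.
have cmk : cmod k%:C = k by rewrite cmodE/= expr0n addr0 sqrtr_sqr gtr0_norm.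
rewrite -(@haar_mul k%:C); first last.
- exact: annulus_ge0.
- exact: measurable_annulus.
- by rewrite -cmod_eq0 cmk gt_eqF.
apply: eq_integral => x _; congr (_ * _)%E; rewrite /annulus !indicE.
by rewrite !mem_setE cmodM cmk !in_itv/= ler_pM2l// ltr_pM2l.
Qed.

Lemma haar_annulus_add s t u : s <= t -> t <= u ->
  haar (annulus s u) = (haar (annulus s t) + haar (annulus t u))%E.
Proof.
move=> st tu; have mC := @cmeasurable_toC R.
have mann a b : measurable_fun setT
    (fun x : plane => (haar_density (toC x) * annulus a b (toC x))%E).
  apply: emeasurable_funM; [exact: measurable_haar_density|exact: measurable_annulus].
rewrite /haar -ge0_integralD//; first last.
- by move=> x _; rewrite mule_ge0// ?haar_density_ge0 ?annulus_ge0.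
- by move=> x _; rewrite mule_ge0// ?haar_density_ge0 ?annulus_ge0.
apply: eq_integral => x _; rewrite -ge0_muleDr ?annulus_ge0//; congr (_ * _)%E.
rewrite /annulus !indicE !mem_setE !in_itv/= -EFinD -natrD; congr (_%:R%:E).
have [r1|r1] := leP t (cmod (toC x)).
  by rewrite (le_trans st r1) andbF.
by rewrite (lt_le_trans r1 tu) andbT addn0.
Qed.

(** The annulus 1 <= |z| < rho^n is the disjoint union of n dilates of
    1 <= |z| < rho, which all have the same Haar measure. *)
Lemma haar_annulus_expn rho n : 1 <= rho ->
  haar (annulus 1 (rho ^+ n)) = (n%:R%:E * haar (annulus 1 rho))%E.
Proof.
move=> r1; have r0 : 0 < rho by exact: lt_le_trans r1.
elim: n => [|n IHn].
  rewrite mul0e /haar integral0_eq// => x _; rewrite /annulus indicE.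
  rewrite mem_setE in_itv/= expr0 [_ && _](_ : _ = false) ?mule0//.
  by rewrite leNgt andNb.
rewrite (@haar_annulus_add _ (rho ^+ n)) ?exprn_ege1//; last first.
  by rewrite exprS ler_peMl ?exprn_ge0// ltW.
have -> : haar (annulus (rho ^+ n) (rho ^+ n.+1)) = haar (annulus 1 rho).
  by rewrite -[RHS](@haar_annulus_scale (rho ^+ n)) ?exprn_gt0// mulr1 -exprSr.
by rewrite IHn -natr1 EFinD ge0_muleDl ?lee_fin// mul1e.
Qed.

(** A test function of positive and finite Haar measure fixes the
    proportionality constant.  The annulus contains a rectangle on which
    |z| < 2, and lies in the square of side 4. *)
Lemma haar_annulus12 : (0 < haar (annulus 1 2) < +oo)%E.
Proof.
have mC := @cmeasurable_toC R.
have mann a b : measurable_fun setT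
    (fun x : plane => (haar_density (toC x) * annulus a b (toC x))%E).
  apply: emeasurable_funM; [exact: measurable_haar_density|exact: measurable_annulus].
have rect a b c e : a <= b -> c <= e ->
    area (`[a, b]%classic `*` `[c, e]%classic) = ((b - a) * (e - c))%:E.
  move=> ab ce; have lebE u v : u <= v -> leb `[u, v]%classic = (v - u)%:E.
    move=> uv; rewrite lebesgue_measure_itv/= lte_fin; case: ltgtP uv => // -> _.
    by rewrite subrr.
  transitivity (leb `[a, b]%classic * leb `[c, e]%classic)%E.
    exact: product_measure1E.
  by rewrite !lebE// EFinM.
have mrect a b c e : measurable (`[a, b]%classic `*` `[c, e]%classic : set plane).
  exact: measurableX.
have n2 x y : cmod (toC (x, y)) ^+ 2 = x ^+ 2 + y ^+ 2 by rewrite sqr_cmod.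
apply/andP; split.
  pose A := `[1, 3 / 2]%classic `*` `[0, 1]%classic : set plane.
  apply: (@lt_le_trans _ _ (\int[area]_x ((4^-1)%:E * (\1_A x)%:E))%E).
    rewrite ge0_integralZl ?lee_fin//; last first.
      by apply/measurable_EFinP; apply: measurable_indic; exact: mrect.
    rewrite integral_indic; [|by []|exact: mrect]; rewrite setIT/= /A rect//; last by lra.
    by rewrite -EFinM lte_fin; lra.
  apply: ge0_le_integral => //.
  - apply: emeasurable_funM => //.
    by apply/measurable_EFinP; apply: measurable_indic; exact: mrect.
  - move=> [x y] _; rewrite indicE.
    have [|_] := boolP ((x, y) \in A); last first.
      by rewrite mule0 mule_ge0 ?haar_density_ge0 ?annulus_ge0.
    rewrite inE /A/= !in_itv/= => -[/andP[x1 x2] /andP[y1 y2]].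
    have c1 : 1 <= cmod (toC (x, y)).
      by rewrite -(@ler_pXn2r _ 2) ?nnegrE ?cmod_ge0// n2 expr1n; nra.
    have c2 : cmod (toC (x, y)) < 2.
      by rewrite -(@ltr_pXn2r _ 2) ?nnegrE ?cmod_ge0// n2; nra.
    rewrite /annulus indicE mem_setE in_itv/= c1 c2 /= -!EFinM lee_fin !mulr1.
    rewrite lef_pV2 ?posrE ?exprn_gt0 ?(lt_le_trans ltr01 c1)// n2; nra.
pose A := `[-2, 2]%classic `*` `[-2, 2]%classic : set plane.
apply: (@le_lt_trans _ _ (\int[area]_x (\1_A x)%:E)%E); last first.
  rewrite integral_indic; [|by []|exact: mrect]; rewrite setIT/= /A rect ?ltry//; lra.
apply: ge0_le_integral => //.
- by move=> x _; rewrite mule_ge0// ?haar_density_ge0 ?annulus_ge0.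
- by apply/measurable_EFinP; apply: measurable_indic; exact: mrect.
- move=> [x y] _; rewrite /annulus indicE mem_setE in_itv/=.
  have [/andP[c1 c2]|_] := boolP (1 <= cmod (toC (x, y)) < 2); last first.
    by rewrite mule0 lee_fin.
  rewrite indicE mem_set/=; last first.
    have : cmod (toC (x, y)) ^+ 2 < 2 ^+ 2 by rewrite ltr_pXn2r ?nnegrE ?cmod_ge0.
    rewrite n2 /A/= !in_itv/= => h; split; apply/andP; split; nra.
  by rewrite mule1 lee_fin invf_le1 ?exprn_ege1// exprn_gt0// (lt_le_trans ltr01 c1).
Qed.

(** The swap identity for d = 1 shows that Haar measure is invariant under
    inversion, which removes the inverse from the identity for general d.  The
    remaining constant is read off the annulus 1 <= |z| < 2, whose preimage is
    1 <= |z| < 2^(1/d). *)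
Lemma haar_pow (d : nat) (f : R[i] -> \bar R) : (0 < d)%N ->
  measurable_fun setT (f \o toC) -> (forall z, 0 <= f z)%E ->
  haar f = (d%:R%:E * haar (fun z => f (z ^+ d)%R))%E.
Proof.
move=> d0 mf f0.
have /andP[g0 goo] := haar_annulus12.
set g := haar (annulus 1 2) in g0 goo.
have gfin : g \is a fin_num by rewrite ge0_fin_numE// ltW.
have mC := @cmeasurable_toC R.
have inv (h : R[i] -> \bar R) : measurable_fun setT (h \o toC) ->
    (forall z, 0 <= h z)%E -> haar (fun z => h z^-1%R) = haar h.
  move=> mh h0; have := @haar_pow_swap 1 h (annulus 1 2) isT mh h0
    (@measurable_annulus _ _) (@annulus_ge0 _ _).
  have -> : haar (fun z => annulus 1 2 (z ^+ 1)%R) = g.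
    by congr haar; apply/funext => z; rewrite expr1.
  have -> : haar (fun z => h (z^-1 ^+ 1)%R) = haar (fun z => h z^-1%R).
    by congr haar; apply/funext => z; rewrite expr1.
  rewrite muleC -/g => /(congr1 (fun x => (g^-1 * x)%E)).
  by rewrite !muleA mulVe ?gt_eqF// !mul1e.
pose rho : R := 2 `^ (d%:R^-1).
have rho0 : 0 < rho by rewrite powR_gt0.
have rhod : rho ^+ d = 2.
  by rewrite -powR_mulrn ?ltW// -powRrM mulVf ?powRr1// pnatr_eq0 -lt0n.
have rho1 : 1 <= rho.
  rewrite leNgt; apply/negP => h.
  have : rho ^+ d <= 1 by rewrite exprn_ile1// ltW.
  by rewrite rhod; lra.
have gE : g = (d%:R%:E * haar (fun z => annulus 1 2 (z ^+ d)%R))%E.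
  rewrite /g -rhod haar_annulus_expn// rhod; congr (_ * _)%E; congr haar.
  apply/funext => z; rewrite /annulus !indicE !mem_setE !in_itv/= cmodX -rhod.
  rewrite ltr_pXn2r ?nnegrE ?cmod_ge0 ?(ltW rho0)//.
  have -> // : (1 <= cmod z ^+ d) = (1 <= cmod z).
  by rewrite -[X in X <= _](expr1n R d) ler_pXn2r ?nnegrE ?cmod_ge0.
have := @haar_pow_swap d f (annulus 1 2) d0 mf f0
    (@measurable_annulus _ _) (@annulus_ge0 _ _).
rewrite (inv (fun z => f (z ^+ d)%R)); first last.
- by move=> z; exact: f0.
- by apply: (cmeasurable_comp mf); exact: cmeasurableX.
move=> /(congr1 (fun x => (d%:R%:E * x)%E)).
rewrite muleCA -gE -/g muleC muleCA => /(congr1 (fun x => (g^-1 * x)%E)).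
by rewrite !muleA mulVe ?gt_eqF// !mul1e.
Qed.

End Haar.

(** * Changes of variables for complex integrals *)

Section ComplexIntegral.
Local Open Scope classical_set_scope.
Local Open Scope ring_scope.
Context {R : realType}.
Local Notation leb := (@lebesgue_measure R).
Local Notation area := (@area R).
Local Notation RR := (measurableTypeR R).
Local Notation plane := (RR * RR)%type.

(** Powers of |z| with real exponents behave irregularly at 0; as the origin
    is a null set, identities between integrands are needed elsewhere only. *)
Lemma ae_eq_plane (T : Type) (F G : R[i] -> T) :
  (forall z, z != 0 -> F z = G z) -> ae_eq area setT (F \o toC) (G \o toC).
Proof.
move=> FG; exists ([set 0] `*` [set 0]); split.
- by apply: measurableX; exact: measurable_set1.
- transitivity (leb [set 0%R : R] * leb [set 0%R : R])%E.
    by apply: product_measure1E; exact: measurable_set1.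
  by rewrite lebesgue_measure_set1 mul0e.
- move=> [x y] /= /not_implyP[_ nFG].
  have : toC (x, y) = 0 by apply: contra_notP nFG => /eqP; exact: FG.
  by rewrite /toC/= => -[-> ->].
Qed.

(** The Haar version applied to |z|^2 F(z). *)
Lemma ge0_integral_pow (d : nat) (F : R[i] -> \bar R) : (0 < d)%N ->
  measurable_fun setT (F \o toC) -> (forall z, 0 <= F z)%E ->
  (\int[area]_x F (toC x) = \int[area]_x
    ((d%:R * cmod (toC x) ^+ (2 * d.-1))%:E * F (toC x ^+ d)%R))%E.
Proof.
move=> d0 mF F0; have mC := @cmeasurable_toC R.
pose G z := ((cmod z ^+ 2)%:E * F z)%E.
have G0 z : (0 <= G z)%E by rewrite /G mule_ge0// lee_fin sqr_ge0.
have mG : measurable_fun setT (G \o toC).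
  apply: emeasurable_funM => //; apply/measurable_EFinP.
  by apply: measurable_funX; exact: measurable_cmod.
have mGd : measurable_fun setT ((fun z => G (z ^+ d)) \o toC).
  by apply: (cmeasurable_comp mG); exact: cmeasurableX.
transitivity (haar G).
  apply: ge0_ae_eq_integral => //.
  - by apply: emeasurable_funM => //; exact: measurable_haar_density.
  - by move=> x _; rewrite mule_ge0// haar_density_ge0.
  - apply: (@ae_eq_plane _ F (fun z => haar_density z * G z)%E) => z z0.
    rewrite /G/haar_density muleA -EFinM mulVf ?mul1e//.
    by rewrite expf_neq0// cmod_eq0.
rewrite (haar_pow d0)// -haarZl//.
apply: ge0_ae_eq_integral => //.
- apply: emeasurable_funM => //; first exact: measurable_haar_density.
  by apply: emeasurable_funM.
- apply: emeasurable_funM; last by apply: (cmeasurable_comp mF); exact: cmeasurableX.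
  apply/measurable_EFinP; apply: measurable_funM => //.
  by apply: measurable_funX; exact: measurable_cmod.
- by move=> x _; rewrite mule_ge0 ?haar_density_ge0// mule_ge0// lee_fin.
- by move=> x _; rewrite mule_ge0// lee_fin mulr_ge0// exprn_ge0// cmod_ge0.
- apply: (@ae_eq_plane _ (fun z => haar_density z * (d%:R%:E * G (z ^+ d)%R))%E
    (fun z => (d%:R * cmod z ^+ (2 * d.-1))%:E * F (z ^+ d)%R)%E) => z z0.
  rewrite /G/haar_density !muleA -!EFinM; congr (_%:E * _)%E.
  have -> : cmod (z ^+ d) ^+ 2 = cmod z ^+ 2 * cmod z ^+ (2 * d.-1).
    by rewrite cmodX -exprM -exprD -{1}(prednK d0) mulnC mulnS.
  by rewrite -mulrA mulrCA mulKf// expf_neq0// cmod_eq0.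
Qed.

(** The integral of a signed function is by definition a difference of two
    nonnegative ones, so changes of variables pass to signed integrands even
    when the integral diverges. *)
Lemma integral_pos_neg_parts (f : R[i] -> R) :
  (\int[area]_x (f (toC x))%:E =
   \int[area]_x (Num.max (f (toC x)) 0)%:E -
   \int[area]_x (Num.max (- f (toC x)) 0)%:E)%E.
Proof.
rewrite integralE; congr (_ - _)%E; apply: eq_integral => x _.
  by rewrite funeposE EFin_max.
by rewrite funenegE EFin_max EFinN.
Qed.

Lemma integral_pow (d : nat) (f : R[i] -> R) : (0 < d)%N ->
  measurable_fun setT ((f : R[i] -> RR) \o toC) ->
  (\int[area]_x (f (toC x))%:E = \int[area]_x
    (d%:R * cmod (toC x) ^+ (2 * d.-1) * f (toC x ^+ d))%:E)%E.
Proof.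
move=> d0 mf.
have k0 (z : R[i]) : 0 <= d%:R * cmod z ^+ (2 * d.-1).
  by rewrite mulr_ge0// exprn_ge0// cmod_ge0.
rewrite integral_pos_neg_parts.
rewrite (integral_pos_neg_parts (fun z => d%:R * cmod z ^+ (2 * d.-1) * f (z ^+ d))).
congr (_ - _)%E.
  rewrite (@ge0_integral_pow d (fun z => (Num.max (f z) 0)%:E))//.
  - by apply: eq_integral => x _; rewrite -EFinM maxr_pMr// mulr0.
  - by apply/measurable_EFinP; apply: measurable_maxr.
  - by move=> z; rewrite lee_fin le_max lexx orbT.
rewrite (@ge0_integral_pow d (fun z => (Num.max (- f z) 0)%:E))//.
- by apply: eq_integral => x _; rewrite -EFinM maxr_pMr// mulr0 mulrN.
- apply/measurable_EFinP; apply: measurable_maxr => //.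
  exact: measurableT_comp.
- by move=> z; rewrite lee_fin le_max lexx orbT.
Qed.

Lemma integral_rotate (u : R[i]) (f : R[i] -> R) : cmod u = 1 ->
  measurable_fun setT ((f : R[i] -> RR) \o toC) ->
  (\int[area]_x (f (toC x))%:E = \int[area]_x (f (u * toC x))%:E)%E.
Proof.
move=> u1 mf.
have u0 : u != 0 by rewrite -cmod_eq0 u1 oner_eq0.
rewrite integral_pos_neg_parts.
rewrite (integral_pos_neg_parts (fun z => f (u * z))).
congr (_ - _)%E.
  rewrite (@ge0_integral_cmul _ u (fun z => (Num.max (f z) 0)%:E))//.
  - by rewrite u1 expr1n mul1e.
  - by apply/measurable_EFinP; apply: measurable_maxr.
  - by move=> z; rewrite lee_fin le_max lexx orbT.
rewrite (@ge0_integral_cmul _ u (fun z => (Num.max (- f z) 0)%:E))//.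
- by rewrite u1 expr1n mul1e.
- apply/measurable_EFinP; apply: measurable_maxr => //.
  exact: measurableT_comp.
- by move=> z; rewrite lee_fin le_max lexx orbT.
Qed.

Local Notation Cmeasurable f := (cmeasurable (fun x : plane => f (toC x))).

Lemma eq_integral_dA (f g : R[i] -> R[i]) :
  Cmeasurable f -> Cmeasurable g -> (forall z, z != 0 -> f z = g z) ->
  integral_dA f = integral_dA g.
Proof.
move=> [mfr mfi] [mgr mgi] fg; rewrite /integral_dA.
congr (_ * (fine _ +i* fine _)); apply: ae_eq_integral => //;
  try exact/measurable_EFinP.
  apply: (@ae_eq_plane _ (fun z => (complex.Re (f z))%:E)
    (fun z => (complex.Re (g z))%:E)) => z z0; by rewrite fg.
apply: (@ae_eq_plane _ (fun z => (complex.Im (f z))%:E)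
  (fun z => (complex.Im (g z))%:E)) => z z0; by rewrite fg.
Qed.

Lemma integral_dA_pow (d : nat) (f : R[i] -> R[i]) : (0 < d)%N ->
  Cmeasurable f ->
  integral_dA f =
  integral_dA (fun z => (d%:R * cmod z ^+ (2 * d.-1))%:C * f (z ^+ d)).
Proof.
move=> d0 [mfr mfi]; rewrite /integral_dA.
congr (_ * (fine _ +i* fine _)).
  rewrite (integral_pow d0 (f:=fun z => complex.Re (f z)))//.
  apply: eq_integral => x _; congr EFin; rewrite /toC.
  by case: (f _) => a b /=; rewrite mul0r subr0.
rewrite (integral_pow d0 (f:=fun z => complex.Im (f z)))//.
apply: eq_integral => x _; congr EFin; rewrite /toC.
by case: (f _) => a b /=; rewrite mul0r addr0.
Qed.

Lemma integral_dA_rotate (u : R[i]) (f : R[i] -> R[i]) : cmod u = 1 ->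
  Cmeasurable f -> integral_dA f = integral_dA (fun z => f (u * z)).
Proof.
move=> u1 [mfr mfi]; rewrite /integral_dA.
congr (_ * (fine _ +i* fine _)).
  by rewrite (integral_rotate u1 (f:=fun z => complex.Re (f z))).
by rewrite (integral_rotate u1 (f:=fun z => complex.Im (f z))).
Qed.

Definition cintegrable (f : R[i] -> R[i]) :=
  area.-integrable setT (fun x => (complex.Re (f (toC x)))%:E) /\
  area.-integrable setT (fun x => (complex.Im (f (toC x)))%:E).

Lemma integral_dAD (f g : R[i] -> R[i]) : cintegrable f -> cintegrable g ->
  integral_dA (fun z => f z + g z) = integral_dA f + integral_dA g.
Proof.
move=> [fr fi] [gr gi]; rewrite /integral_dA -mulrDr; congr (_ * _).
have addcE (a b c e : R) : (a + c) +i* (b + e) = (a +i* b) + (c +i* e) by [].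
rewrite -addcE; congr (_ +i* _).
  rewrite -RintegralD//; apply: eq_Rintegral => x _.
  by case: (f _) (g _) => [? ?] [? ?].
rewrite -RintegralD//; apply: eq_Rintegral => x _.
by case: (f _) (g _) => [? ?] [? ?].
Qed.

Lemma integral_dAZ (k : R[i]) (f : R[i] -> R[i]) : cintegrable f ->
  integral_dA (fun z => k * f z) = k * integral_dA f.
Proof.
move=> [fr fi]; rewrite /integral_dA mulrCA; congr (_ * _).
case: k => a b.
have mulcE (c e : R) : (a +i* b) * (c +i* e) = (a * c - b * e) +i* (a * e + b * c) by [].
rewrite mulcE; congr (_ +i* _).
  rewrite -!RintegralZl// -RintegralB//; first last.
  - exact: (integrableZl measurableT b fi).
  - exact: (integrableZl measurableT a fr).
  by apply: eq_Rintegral => x _; case: (f _) => [? ?].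
rewrite -!RintegralZl// -RintegralD//; first last.
- exact: (integrableZl measurableT b fr).
- exact: (integrableZl measurableT a fi).
by apply: eq_Rintegral => x _; case: (f _) => [? ?].
Qed.

Lemma integral_dA_conj (f : R[i] -> R[i]) : cintegrable f ->
  integral_dA (fun z => (f z)^*) = (integral_dA f)^*.
Proof.
move=> [fr fi]; rewrite /integral_dA rmorphM/=; congr (_ * _).
  by rewrite conj_ReIm oppr0.
rewrite [RHS]conj_ReIm; congr (_ +i* _).
  by apply: eq_Rintegral => x _; rewrite conj_ReIm.
rewrite -[RHS]mulN1r -RintegralZl//.
by apply: eq_Rintegral => x _; rewrite conj_ReIm mulN1r.
Qed.

End ComplexIntegral.

(** * Uniqueness of orthonormal polynomials *)

Lemma poly_span (F : fieldType) (p : nat -> {poly F}) n (f : {poly F}) :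
  (forall j, size (p j) = j.+1) -> (size f <= n)%N ->
  exists a : nat -> F, f = \sum_(k < n) a k *: p k.
Proof.
move=> sp; elim: n f => [|n IHn] f sf.
  exists (fun=> 0); rewrite big_ord0; apply/eqP.
  by rewrite -size_poly_leq0.
pose b := f`_n / (p n)`_n.
have pn0 : (p n)`_n != 0.
  have := lead_coefE (p n); rewrite sp /= => <-.
  by rewrite lead_coef_eq0 -size_poly_eq0 sp.
have [|a fa] := IHn (f - b *: p n).
  apply/leq_sizeP => j; rewrite leq_eqVlt => /predU1P[<-|nj].
    by rewrite coefB coefZ /b divfK// subrr.
  rewrite coefB coefZ !nth_default ?mulr0 ?subrr// ?sp//.
  exact: leq_trans nj.
exists (fun k => if k == n then b else a k).
rewrite big_ord_recr/= eqxx -[LHS](subrK (b *: p n)) fa; congr (_ + _).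
by apply: eq_bigr => k _; rewrite ltn_eqF.
Qed.

Section Uniqueness.
Local Open Scope classical_set_scope.
Local Open Scope ring_scope.
Context {R : rcfType}.
Implicit Types (B : {poly R[i]} -> {poly R[i]} -> R[i]) (p r : nat -> {poly R[i]}).

Definition orthonormal_family B p :=
  (forall j, size (p j) = j.+1 /\ 0 < lead_coef (p j)) /\
  (forall j k, B (p j) (p k) = (j == k)%:R).

(** By strong induction p and r agree below n.  With kap the quotient of the
    leading coefficients, p_n - kap r_n has degree < n, hence is a combination
    of the p_k with k < n; it is orthogonal to all of them, so it is zero.
    Then kap^2 = 1 by normalisation and kap > 0. *)
Lemma orthonormal_family_unique B p r :
  (forall f g h, B (f + g) h = B f h + B g h) ->
  (forall a f h, B (a *: f) h = a * B f h) ->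
  (forall f g, B g f = (B f g)^*) ->
  orthonormal_family B p -> orthonormal_family B r -> p =1 r.
Proof.
move=> BD BZ Bconj [sp op] [sr orr].
move=> n; have [m] := ubnP n; elim: m n => // m IHm n; rewrite ltnS => nm.
have IH k : (k < n)%N -> p k = r k by move=> kn; apply: IHm; exact: leq_trans nm.
have [szp lp] := sp n; have [szr lr] := sr n.
pose kap := lead_coef (p n) / lead_coef (r n).
have kap0 : 0 < kap by rewrite divr_gt0.
have [|a fa] := @poly_span _ p n (p n - kap *: r n) (fun j => (sp j).1).
  apply/leq_sizeP => j; rewrite leq_eqVlt => /predU1P[<-|nj].
    rewrite coefB coefZ.
    have := lead_coefE (p n); have := lead_coefE (r n); rewrite szp szr/= => <- <-.
    by rewrite /kap divfK ?subrr// gt_eqF.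
  by rewrite coefB coefZ !nth_default ?mulr0 ?subrr// ?szp ?szr.
have BN f g h : B (f - g) h = B f h - B g h.
  by rewrite BD -scaleN1r BZ mulN1r.
have Bsum k (b : nat -> R[i]) h :
    B (\sum_(j < k) b j *: p j) h = \sum_(j < k) b j * B (p j) h.
  elim: k => [|k IHk]; first by rewrite !big_ord0 -(scale0r 0) BZ mul0r.
  by rewrite !big_ord_recr/= BD IHk BZ.
have a0 k : (k < n)%N -> a k = 0.
  move=> kn; transitivity (B (p n - kap *: r n) (p k)).
    rewrite fa Bsum (bigD1 (Ordinal kn))//= op eqxx mulr1 big1 ?addr0// => j jk.
    rewrite op; case: eqP => [jk'|_]; last by rewrite mulr0.
    by move/eqP: jk; case; apply: val_inj.
  rewrite BN BZ op gtn_eqF// IH// orr gtn_eqF// mulr0 subrr //.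
have E : p n = kap *: r n.
  apply/eqP; rewrite -subr_eq0 fa big1// => k _.
  by rewrite a0// scale0r.
have k2 : kap * kap^* = 1.
  have : B (p n) (p n) = 1 by rewrite op eqxx.
  by rewrite E BZ Bconj BZ orr eqxx mulr1.
suff k1 : kap = 1 by rewrite E k1 scale1r.
have kapr : kap^* = kap by apply/CrealP; rewrite gtr0_real.
apply/eqP; rewrite -sqrp_eq1 ?ltW// expr2 -{2}kapr.
by rewrite k2.
Qed.

End Uniqueness.

(** * Weighted inner products of polynomials *)

Section WeightedProduct.
Local Open Scope classical_set_scope.
Local Open Scope ring_scope.
Context {R : realType}.
Local Notation area := (@area R).
Local Notation RR := (measurableTypeR R).
Local Notation plane := (RR * RR)%type.
Local Notation Cmeasurable f := (cmeasurable (fun x : plane => f (toC x))).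
Variable w : R[i] -> R.
Hypothesis mw : measurable_fun setT ((w : R[i] -> RR) \o toC).
Hypothesis w0 : forall z, 0 <= w z.
Implicit Types f g h : {poly R[i]}.

Definition wprod f g : R[i] :=
  integral_dA (fun z => f.[z] * (g.[z])^* * (w z)%:C).

Definition sq_integrable f :=
  area.-integrable setT (fun x => (cmod f.[toC x] ^+ 2 * w (toC x))%:E).

Lemma mulcJ_cmod (z : R[i]) : z * z^* = (cmod z ^+ 2)%:C.
Proof.
rewrite sqr_cmod; case: z => a b; apply/eqP; rewrite eq_complex.
by apply/andP; split; apply/eqP => /=; ring.
Qed.

Lemma cmodJ (z : R[i]) : cmod z^* = cmod z.
Proof. by rewrite !cmodE; case: z => a b /=; rewrite sqrrN. Qed.

Lemma measurable_wprod f g :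
  Cmeasurable (fun z => f.[z] * (g.[z])^* * (w z)%:C).
Proof.
have mC := @cmeasurable_toC R.
apply: cmeasurableM; last exact: cmeasurable_real.
apply: cmeasurableM; first exact: cmeasurable_horner.
by apply: cmeasurable_conj; exact: cmeasurable_horner.
Qed.

Lemma measurable_sq f :
  measurable_fun setT (fun x : plane => (cmod f.[toC x] ^+ 2 * w (toC x))%:E).
Proof.
apply/measurable_EFinP; apply: measurable_funM => //.
apply: measurable_funX; apply: measurable_cmod; apply: cmeasurable_horner.
exact: cmeasurable_toC.
Qed.

(** A divergent integral has real value 0 by convention, so a nonzero value
    witnesses convergence. *)
Lemma sq_integrable_unit f : wprod f f = 1 -> sq_integrable f.
Proof.
move=> ff; apply/integrableP; split; first exact: measurable_sq.
under eq_integral => x _ do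
  rewrite gee0_abs ?lee_fin ?(mulr_ge0 (sqr_ge0 _) (w0 _))//.
rewrite ltey; apply/negP => /eqP foo.
move: ff; rewrite /wprod /integral_dA.
under eq_Rintegral do rewrite mulcJ_cmod /= mulr0 subr0.
rewrite /Rintegral foo /= => /(congr1 (@complex.Re R)) /=.
by rewrite mulr0 mul0r subr0 => /eqP; rewrite eq_sym oner_eq0.
Qed.

Lemma sq_integrable0 : sq_integrable 0.
Proof.
rewrite /sq_integrable (_ : (fun _ => _) = cst 0%E); first exact: integrable0.
apply/funext => x; rewrite horner0 (_ : cmod 0 = 0) ?expr0n ?mul0r//.
by apply/eqP; rewrite cmod_eq0.
Qed.

Lemma sq_integrableZ a f : sq_integrable f -> sq_integrable (a *: f).
Proof.
move=> sf; have := integrableZl measurableT (cmod a ^+ 2) sf.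
apply: eq_integrable => // x _.
by rewrite /= -EFinM hornerZ cmodM exprMn mulrA.
Qed.

Lemma cmodD_sq (u v : R[i]) : cmod (u + v) ^+ 2 <= 2 * (cmod u ^+ 2 + cmod v ^+ 2).
Proof.
rewrite !sqr_cmod; case: u v => [a b] [c e] /=.
have := sqr_ge0 (a - c); have := sqr_ge0 (b - e); nra.
Qed.

Lemma sq_integrableD f g : sq_integrable f -> sq_integrable g ->
  sq_integrable (f + g).
Proof.
move=> sf sg.
have := integrableZl measurableT 2 (integrableD measurableT sf sg).
apply: le_integrable => //; first exact: measurable_sq.
move=> x _; rewrite /= lee_fin hornerD -mulrDl mulrA.
rewrite !ger0_norm ?mulr_ge0 ?addr_ge0 ?sqr_ge0 ?w0 ?cmod_ge0//.
by rewrite ler_wpM2r ?w0// ?cmodD_sq ?cmod_ge0.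
Qed.

Lemma sq_integrable_all (p : nat -> {poly R[i]}) f :
  (forall j, size (p j) = j.+1) -> (forall j, sq_integrable (p j)) ->
  sq_integrable f.
Proof.
move=> sp ip; have [a ->] := poly_span sp (leqnn (size f)).
elim/big_ind: _ => //; first exact: sq_integrable0.
- by move=> ? ?; exact: sq_integrableD.
- by move=> k _; exact: sq_integrableZ.
Qed.

(** Domination by |f|^2 + |g|^2. *)
Lemma cintegrable_wprod f g : sq_integrable f -> sq_integrable g ->
  cintegrable (fun z => f.[z] * (g.[z])^* * (w z)%:C).
Proof.
move=> sf sg; have [mr mi] := measurable_wprod f g.
have fg x : cmod (f.[toC x] * (g.[toC x])^* * (w (toC x))%:C) <=
    cmod f.[toC x] ^+ 2 * w (toC x) + cmod g.[toC x] ^+ 2 * w (toC x).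
  have cw : cmod (w (toC x))%:C = w (toC x).
    by rewrite cmodE/= expr0n addr0 sqrtr_sqr ger0_norm.
  rewrite !cmodM cmodJ cw -mulrDl ler_wpM2r//.
  have := sqr_ge0 (cmod f.[toC x] - cmod g.[toC x]).
  have := cmod_ge0 f.[toC x]; have := cmod_ge0 g.[toC x]; nra.
have reim (z : R[i]) : `|complex.Re z| <= cmod z /\ `|complex.Im z| <= cmod z.
  rewrite -!sqrtr_sqr cmodE; split; rewrite ler_wsqrtr// ?lerDl ?lerDr sqr_ge0//.
have := integrableD measurableT sf sg.
split; apply: (le_integrable measurableT) (integrableD measurableT sf sg);
  try exact/measurable_EFinP; move=> x _; rewrite lee_fin [leRHS]ger0_norm.
- exact: le_trans (reim _).1 (fg x).
- by rewrite addr_ge0// mulr_ge0// sqr_ge0.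
- exact: le_trans (reim _).2 (fg x).
- by rewrite addr_ge0// mulr_ge0// sqr_ge0.
Qed.

Lemma wprodD f g h : sq_integrable f -> sq_integrable g -> sq_integrable h ->
  wprod (f + g) h = wprod f h + wprod g h.
Proof.
move=> sf sg sh; rewrite /wprod -integral_dAD; try exact: cintegrable_wprod.
congr integral_dA; apply/funext => z; rewrite hornerD.
by rewrite !mulrDl.
Qed.

Lemma wprodZ a f h : sq_integrable f -> sq_integrable h ->
  wprod (a *: f) h = a * wprod f h.
Proof.
move=> sf sh; rewrite /wprod -integral_dAZ; last exact: cintegrable_wprod.
by congr integral_dA; apply/funext => z; rewrite hornerZ !mulrA.
Qed.

Lemma wprodC f h : sq_integrable f -> sq_integrable h ->
  wprod h f = (wprod f h)^*.
Proof.
move=> sf sh; rewrite /wprod -integral_dA_conj; last exact: cintegrable_wprod.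
congr integral_dA; apply/funext => z; rewrite !rmorphM/= conjCK [(_%:C)^*]conj_ReIm oppr0.
by congr (_ * _); rewrite mulrC.
Qed.

Lemma wprod_unique p r :
  orthonormal_family wprod p -> orthonormal_family wprod r -> p =1 r.
Proof.
move=> op orr; have sqf f : sq_integrable f.
  apply: (@sq_integrable_all p) => j; first by have [[]] := op.1 j.
  by apply: sq_integrable_unit; rewrite op.2 eqxx.
apply: orthonormal_family_unique op orr.
- by move=> *; exact: wprodD.
- by move=> *; exact: wprodZ.
- by move=> *; exact: wprodC.
Qed.

End WeightedProduct.

(** * The orthonormal family lifted through the power map *)

Section PowerFamily.
Local Open Scope classical_set_scope.
Local Open Scope ring_scope.
Context {R : realType}.
Local Notation RR := (measurableTypeR R).
Local Notation plane := (RR * RR)%type.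
Local Notation Cmeasurable f := (cmeasurable (fun x : plane => f (toC x))).

Lemma weight_ge0 (W : R[i] -> R) c n z : 0 <= weight W c n z.
Proof. by rewrite mulr_ge0 ?powR_ge0 ?expR_ge0. Qed.

Lemma measurable_weight (W : R[i] -> R) c n :
  measurable_fun setT ((W : R[i] -> RR) \o toC) ->
  measurable_fun setT ((weight W c n : R[i] -> RR) \o toC).
Proof.
move=> mW; apply: measurable_funM.
  apply: (measurableT_comp (measurable_powR _)).
  by apply: measurable_cmod; exact: cmeasurable_toC.
apply: measurableT_comp => //; apply: measurableT_comp => //.
exact: measurable_funM.
Qed.

Lemma measurable_Q (a : R) : measurable_fun setT ((Q a : R[i] -> RR) \o toC).
Proof.
apply: measurable_funX; apply: measurable_cmod; apply: cmeasurableD.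
  exact: cmeasurable_toC.
exact: cmeasurable_cst.
Qed.

Lemma measurable_V d (a : R) : measurable_fun setT ((V d a : R[i] -> RR) \o toC).
Proof.
apply: measurable_funM => //; apply: (cmeasurable_comp (measurable_Q a)).
by apply: cmeasurableX; exact: cmeasurable_toC.
Qed.

(** Index m = d j + l stands for sqrt d * z^l * p^l_j(z^d); the factor sqrt d
    compensates the Jacobian of the power map. *)
Definition power_family d (p : nat -> nat -> {poly R[i]}) m : {poly R[i]} :=
  (Num.sqrt d%:R)%:C *: ('X^(m %% d) * (p (m %% d)%N (m %/ d)%N \Po 'X^d)).

Lemma horner_power_family d p m z :
  (power_family d p m).[z] =
  (Num.sqrt d%:R)%:C * z ^+ (m %% d) * (p (m %% d)%N (m %/ d)%N).[z ^+ d].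
Proof.
by rewrite /power_family hornerZ hornerM hornerXn horner_comp hornerXn mulrA.
Qed.

Lemma size_power_family d (p : nat -> nat -> {poly R[i]}) : (0 < d)%N ->
  (forall l, (l < d)%N -> forall j, size (p l j) = j.+1 /\ 0 < lead_coef (p l j)) ->
  forall m, size (power_family d p m) = m.+1 /\ 0 < lead_coef (power_family d p m).
Proof.
move=> d0 hp m; have [szp lp] := hp _ (ltn_pmod m d0) (m %/ d)%N.
have sd0 : (Num.sqrt d%:R)%:C != 0 :> R[i].
  by rewrite -[X in X != _]/(_%:C) (inj_eq (@complexI R)) gt_eqF// sqrtr_gt0 ltr0n.
have sc : (size (p (m %% d)%N (m %/ d)%N \Po 'X^d)) = ((m %/ d) * d).+1%N.
  have := size_comp_poly (p (m %% d)%N (m %/ d)%N) ('X^d).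
  rewrite szp size_polyXn /= => <-; rewrite prednK// lt0n size_poly_eq0.
  by rewrite comp_poly_eq0 ?size_polyXn// -size_poly_eq0 szp.
split.
  rewrite size_scale// size_monicM ?monicXn//; last by rewrite -size_poly_eq0 sc.
  by rewrite size_polyXn sc addSn/= addnS addnC -divn_eq.
rewrite lead_coefZ lead_coefM lead_coefXn mul1r lead_coef_comp ?size_polyXn//.
by rewrite lead_coefXn expr1n mulr1 mulr_gt0// ltcR sqrtr_gt0 ltr0n.
Qed.

Lemma weight_VE d (a c : R) N z : (0 < d)%N ->
  weight (V d a) c (d * N) z =
  cmod z `^ (2 * c) * expR (- (N%:R * Q a (z ^+ d))).
Proof.
move=> d0; rewrite /weight /V natrM; congr (_ * expR (- _)).
by field; rewrite pnatr_eq0 -lt0n.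
Qed.

(** A primitive d-th root of unity. *)
Definition rotation d : R[i] := cos (2 * pi / d%:R) +i* sin (2 * pi / d%:R).

Lemma rotation_expn d k : rotation d ^+ k =
  cos (2 * (pi * k%:R / d%:R)) +i* sin (2 * (pi * k%:R / d%:R)).
Proof.
rewrite /rotation cos_sin_expn.
by have -> : k%:R * (2 * pi / d%:R) = 2 * (pi * k%:R / d%:R) :> R by ring.
Qed.

Lemma rotation_order d : (0 < d)%N -> rotation d ^+ d = 1.
Proof.
move=> d0; rewrite rotation_expn mulfK ?pnatr_eq0 -?lt0n//.
by rewrite mulr_natl cos2pi sin2pi.
Qed.

(** With x = pi k / d in ]0, pi[ the real part is 1 - 2 sin^2 x < 1. *)
Lemma rotation_neq1 d k : (0 < k < d)%N -> rotation d ^+ k != 1.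
Proof.
move=> /andP[k0 kd]; have dn0 : (0 < d)%N by exact: leq_trans kd.
have d0 : 0 < d%:R :> R by rewrite ltr0n.
rewrite rotation_expn eq_complex negb_and /= mulr_natl cos_mulr2n; apply/orP; left.
have : 0 < sin (pi * k%:R / d%:R : R).
  apply: sin_gt0_pi; rewrite divr_gt0 ?mulr_gt0 ?pi_gt0 ?ltr0n//=.
  by rewrite ltr_pdivrMr// ltr_pM2l ?pi_gt0// ltr_nat.
move=> /(exprn_gt0 2); rewrite cos2sin2 => h.
by rewrite lt_eqF//; lra.
Qed.

Lemma cmod_rotation d : cmod (rotation d) = 1.
Proof. by rewrite cmodE /= cos2Dsin2 sqrtr1. Qed.

Lemma rotation_neq0 d : rotation d != 0.
Proof. by rewrite -cmod_eq0 cmod_rotation oner_eq0. Qed.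

Lemma rotation_inj d k l : (k < d)%N -> (l < d)%N ->
  rotation d ^+ k = rotation d ^+ l -> k = l.
Proof.
wlog kl : k l / (k <= l)%N => [H kd ld e|kd ld e].
  by have [kl|/ltnW kl] := leqP k l; [exact: H|apply/esym/H].
apply/eqP; move: kl; rewrite leq_eqVlt => /predU1P[->//|kl].
have := @rotation_neq1 d (l - k); rewrite subn_gt0 kl (leq_ltn_trans (leq_subr _ _) ld).
move=> /(_ isT) /eqP; case.
have wk0 : rotation d ^+ k != 0 by rewrite expf_neq0// rotation_neq0.
by apply: (mulfI wk0); rewrite -exprD subnKC ?(ltnW kl)// mulr1.
Qed.

(** Rotating the variable by a d-th root of unity multiplies the integral by
    a number different from 1 without changing its value. *)
Lemma wprod_power_family_neq (w : R[i] -> R) d p j k : (0 < d)%N ->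
  measurable_fun setT ((w : R[i] -> RR) \o toC) -> (forall z, 0 <= w z) ->
  (forall z, w (rotation d * z) = w z) ->
  (forall f, sq_integrable w f) -> (j %% d != k %% d)%N ->
  wprod w (power_family d p j) (power_family d p k) = 0.
Proof.
move=> d0 mw w0 wrot sqf jk.
set f := power_family d p j; set g := power_family d p k.
pose kap := rotation d ^+ (j %% d) * (rotation d ^+ (k %% d))^*.
have kapX : wprod w f g = kap * wprod w f g.
  rewrite -integral_dAZ; last exact: cintegrable_wprod.
  rewrite {1}/wprod (integral_dA_rotate (cmod_rotation d)); last exact: measurable_wprod.
  congr integral_dA; apply/funext => z; rewrite wrot !horner_power_family.
  rewrite !exprMn rotation_order// mul1r !rmorphM/= /kap.
  ring.
have [kap1|kap1] := eqVneq kap 1; last first.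
  apply/eqP; have /eqP : (1 - kap) * wprod w f g = 0.
    by rewrite mulrBl mul1r -kapX subrr.
  by rewrite mulf_eq0 subr_eq0 eq_sym (negbTE kap1).
case/eqP: jk; apply: (@rotation_inj d); rewrite ?ltn_pmod//.
have : kap * rotation d ^+ (k %% d) = rotation d ^+ (k %% d) by rewrite kap1 mul1r.
rewrite /kap -mulrA [_^* * _]mulrC mulcJ_cmod cmodX cmod_rotation !expr1n.
by rewrite mulr1.
Qed.

(** The change of variables w = z^d; away from 0 the powers of |z| match
    because 2 l + 2 c = 2 (d - 1) + 2 d gamma with gamma = (c + l + 1) / d - 1. *)
Lemma wprod_power_family_eq (a c : R) N d p j k : (0 < d)%N ->
  (j %% d = k %% d)%N ->
  wprod (weight (V d a) c (d * N)) (power_family d p j) (power_family d p k) =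
  wprod (weight (Q a) ((c + (j %% d)%:R + 1) / d%:R - 1) N)
    (p (j %% d)%N (j %/ d)%N) (p (k %% d)%N (k %/ d)%N).
Proof.
move=> d0 jk; have mC := @cmeasurable_toC R.
set gam := _ / _ - 1.
have mQ : measurable_fun setT ((weight (Q a) gam N : R[i] -> RR) \o toC).
  by apply: measurable_weight; exact: measurable_Q.
have mV : measurable_fun setT ((weight (V d a) c (d * N) : R[i] -> RR) \o toC).
  by apply: measurable_weight; exact: measurable_V.
rewrite [RHS]/wprod (integral_dA_pow d0); last exact: measurable_wprod.
apply: eq_integral_dA; first exact: measurable_wprod.
  apply: cmeasurableM.
    apply: cmeasurable_real; apply: measurable_funM => //.
    by apply: measurable_funX; exact: measurable_cmod.
  exact: (cmeasurable_ccomp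
    (measurable_wprod mQ (p (j %% d)%N (j %/ d)%N) (p (k %% d)%N (k %/ d)%N))
    (cmeasurableX d mC)).
move=> z z0; rewrite !horner_power_family -jk weight_VE//.
set l := (j %% d)%N; set P := (p _ _).[_]; set P' := (p _ _).[_].
have cz0 : 0 < cmod z by rewrite cmod_gt0.
have d0' : d%:R != 0 :> R by rewrite pnatr_eq0 -lt0n.
have -> : weight (Q a) gam N (z ^+ d) =
    cmod z `^ (d%:R * (2 * gam)) * expR (- (N%:R * Q a (z ^+ d))).
  by rewrite /weight cmodX -powR_mulrn ?cmod_ge0// -powRrM.
set e := expR _.
have key : (cmod z `^ (2 * l%:R))%:C * (cmod z `^ (2 * c))%:C =
    (cmod z ^+ (2 * d.-1))%:C * (cmod z `^ (d%:R * (2 * gam)))%:C.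
  rewrite -!rmorphM; congr (_%:C).
  rewrite -powR_mulrn ?cmod_ge0// -!powRD ?(gt_eqF cz0) ?implybT//.
  congr (_ `^ _); rewrite natrM /gam -/l -(subn1 d) natrB//; field.
  exact: d0'.
have zz : z ^+ l * (z ^+ l)^* = (cmod z `^ (2 * l%:R))%:C.
  by rewrite mulcJ_cmod cmodX -natrM powR_mulrn ?cmod_ge0// -exprM mulnC.
have ss : (Num.sqrt d%:R)%:C * (Num.sqrt d%:R)%:C = d%:R%:C :> R[i].
  by rewrite -rmorphM -expr2 sqr_sqrtr.
have sJ : ((Num.sqrt d%:R)%:C : R[i])^* = (Num.sqrt d%:R)%:C.
  by rewrite conj_ReIm oppr0.
rewrite !(rmorphM (real_complex R)) !(rmorphM Num.conj)/= sJ -ss.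
transitivity ((Num.sqrt d%:R)%:C * (Num.sqrt d%:R)%:C *
    (z ^+ l * (z ^+ l)^* * (cmod z `^ (2 * c))%:C) * (P * P'^* * e%:C)).
  ring.
rewrite zz key; ring.
Qed.

End PowerFamily.

Section Kernels.
Local Open Scope classical_set_scope.
Local Open Scope ring_scope.
Context {R : realType}.
Implicit Types (a c t s : R) (u z w : R[i]) (p : nat -> nat -> {poly R[i]}).

Lemma weight_V_rotation a c d N z : (0 < d)%N ->
  weight (V d a) c (d * N) (rotation d * z) = weight (V d a) c (d * N) z.
Proof.
move=> d0; rewrite (weight_VE a c N (rotation d * z) d0) (weight_VE a c N z d0).
rewrite cmodM cmod_rotation mul1r exprMn (rotation_order d0).
by rewrite mul1r.
Qed.

Lemma power_family_orthonormal a c d N p : (0 < d)%N ->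
  (forall l, (l < d)%N ->
     orthonormal_polynomials (Q a) ((c + l%:R + 1) / d%:R - 1) N (p l)) ->
  (forall f, sq_integrable (weight (V d a) c (d * N)) f) ->
  orthonormal_family (wprod (weight (V d a) c (d * N))) (power_family d p).
Proof.
move=> d0 hp sqf; split.
  by apply: size_power_family => // l ld; exact: (hp l ld).1.
move=> j k; have [jk|jk] := eqVneq (j %% d)%N (k %% d)%N.
  rewrite wprod_power_family_eq// -jk.
  have := (hp _ (ltn_pmod j d0)).2 (j %/ d)%N (k %/ d)%N.
  rewrite -/(wprod _ _ _) => ->; congr (nat_of_bool _)%:R.
  apply/eqP/eqP => [E|->//].
  by rewrite (divn_eq j d) (divn_eq k d) E jk.
rewrite (negbTE (contraNneq _ jk)) => [|->//].
rewrite mulr0n; apply: (wprod_power_family_neq p d0 _ _ _ sqf jk).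
- by apply: measurable_weight; exact: measurable_V.
- by move=> z; exact: weight_ge0.
- by move=> z; exact: weight_V_rotation.
Qed.

Lemma orthonormal_polynomials_V_unique a c d N p q : (0 < d)%N ->
  orthonormal_polynomials (V d a) c (d * N) q ->
  (forall l, (l < d)%N ->
     orthonormal_polynomials (Q a) ((c + l%:R + 1) / d%:R - 1) N (p l)) ->
  q =1 power_family d p.
Proof.
move=> d0 hq hp.
have mV : measurable_fun setT
    ((weight (V d a) c (d * N) : R[i] -> measurableTypeR R) \o toC).
  by apply: measurable_weight; exact: measurable_V.
have wV z : 0 <= weight (V d a) c (d * N) z by exact: weight_ge0.
apply: (wprod_unique mV wV hq).
apply: power_family_orthonormal => // f.
apply: (@sq_integrable_all _ _ mV wV q) => j; first exact: (hq.1 j).1.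
by apply: sq_integrable_unit => //; rewrite [LHS](hq.2 j j) eqxx.
Qed.

(** * Correlation kernels *)

Lemma sum_mod_div (T : nmodType) (F : nat -> nat -> T) d N : (0 < d)%N ->
  \sum_(m < d * N) F (m %% d)%N (m %/ d)%N = \sum_(l < d) \sum_(j < N) F l j.
Proof.
move=> d0; elim: N => [|N IHN].
  by rewrite muln0 big_ord0 big1// => l _; rewrite big_ord0.
under [RHS]eq_bigr do rewrite big_ord_recr/=.
rewrite big_split/= -IHN mulnS addnC big_split_ord/=; congr (_ + _).
apply: eq_bigr => l _; rewrite mulnC modnMDl modn_small// divnMDl//.
by rewrite divn_small// addn0.
Qed.

Lemma cpowD t u s s' : u != 0 -> cpow t u (s + s') = cpow t u s * cpow t u s'.
Proof.
move=> u0; rewrite /cpow powRD; last by rewrite cmod_eq0 u0 implybT.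
rewrite mulrDl cosD sinD rmorphM mulrACA; congr (_ * _).
by apply/eqP; rewrite eq_complex /= eqxx/= addrC.
Qed.

(** For u = z * conj w, the term of index d j + l carries u^c u^l on the left
    and u^(d-1) (u^d)^gamma on the right; in the branch given by t both are
    u^(c + l). *)
Lemma corr_kernel_power_family a c d N p t z w : (0 < d)%N ->
  z != 0 -> w != 0 -> is_arg t (z * w^*) ->
  corr_kernel (V d a) c (d * N) (power_family d p) t z w =
  d%:R * (z * w^*) ^+ d.-1 *
  \sum_(l < d) corr_kernel (Q a) ((c + l%:R + 1) / d%:R - 1) N (p l)
    (d%:R * t) (z ^+ d) (w ^+ d).
Proof.
move=> d0 z0 w0 ht.
have d0' : d%:R != 0 :> R by rewrite pnatr_eq0 -lt0n.
have u0 : z * w^* != 0 by rewrite mulf_neq0// conjC_eq0.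
have dE : (Num.sqrt d%:R)%:C * ((Num.sqrt d%:R)%:C)^* = d%:R :> R[i].
  by rewrite conj_ReIm oppr0 -rmorphM -expr2 sqr_sqrtr// rmorph_nat.
pose F l j : R[i] := d%:R * (z * w^*) ^+ l * ((p l j).[z ^+ d] * ((p l j).[w ^+ d])^*).
rewrite /corr_kernel.
have -> : \sum_(m < d * N) (power_family d p m).[z] * ((power_family d p m).[w])^* =
    \sum_(l < d) \sum_(j < N) F l j.
  rewrite -sum_mod_div//; apply: eq_bigr => m _.
  rewrite !horner_power_family /F !(rmorphM Num.conj)/= -dE exprMn rmorphXn/=; ring.
rewrite mulr_sumr [RHS]mulr_sumr; apply: eq_bigr => l _.
have -> : z ^+ d * (w ^+ d)^* = (z * w^*) ^+ d by rewrite exprMn rmorphXn.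
rewrite cpowX.
have -> : expR (- ((d * N)%:R / 2 * (V d a z + V d a w))) =
    expR (- (N%:R / 2 * (Q a (z ^+ d) + Q a (w ^+ d)))).
  by congr (expR (- _)); rewrite /V natrM; field.
have key : cpow t (z * w^*) c * (z * w^*) ^+ l = (z * w^*) ^+ d.-1 *
    cpow t (z * w^*) (d%:R * ((c + l%:R + 1) / d%:R - 1)).
  rewrite -!(cpow_nat _ ht) -!cpowD//; congr cpow.
  by rewrite -subn1 natrB//; field.
rewrite /F -!mulr_sumr.
transitivity ((cpow t (z * w^*) c * (z * w^*) ^+ l) * d%:R *
  (expR (- (N%:R / 2 * (Q a (z ^+ d) + Q a (w ^+ d)))))%:C *
  (\sum_(j < N) (p l j).[z ^+ d] * ((p l j).[w ^+ d])^*)); first by ring.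
by rewrite key; ring.
Qed.

Lemma is_argZ t u (k : R) : 0 < k -> is_arg t u -> is_arg t (u * k%:C).
Proof.
move=> k0 ht; have ck : cmod k%:C = k.
  by rewrite cmodE/= expr0n addr0 sqrtr_sqr gtr0_norm.
by rewrite /is_arg cmodM ck rmorphM mulrAC -ht.
Qed.

(** Put r = N^(1/(2d)).  Then r^d = sqrt N, so the points z / r have d-th
    powers z^d / sqrt N, and the factors r^-2 in front and r^(-2(d-1)) from
    (z * conj w)^(d-1) multiply to 1/N. *)
Lemma rescaled_corr_kernel_power_family a c d N p t z w :
  (0 < d)%N -> (0 < N)%N -> z != 0 -> w != 0 -> is_arg t (z * w^*) ->
  rescaled_corr_kernelV d a c (d * N) (power_family d p) t z w =
  d%:R * (z * w^*) ^+ d.-1 *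
  \sum_(l < d) rescaled_corr_kernelQ a ((c + l%:R + 1) / d%:R - 1) N (p l)
    (d%:R * t) (z ^+ d) (w ^+ d).
Proof.
move=> hd hN z0 w0 ht.
rewrite /rescaled_corr_kernelV /rescaled_corr_kernelQ.
have N0 : 0 < N%:R :> R by rewrite ltr0n.
have d0 : d%:R != 0 :> R by rewrite pnatr_eq0 -lt0n.
have -> : (d * N)%:R / d%:R = N%:R :> R by rewrite natrM mulrAC divff ?mul1r.
set r : R := N%:R `^ (2 * d%:R)^-1.
have r0 : 0 < r by rewrite powR_gt0.
have r2 : N%:R `^ d%:R^-1 = r ^+ 2.
  by rewrite -powR_mulrn ?ltW// -powRrM; congr (_ `^ _); field.
have rd : Num.sqrt N%:R = r ^+ d.
  rewrite -powR12_sqrt ?ltW// -powR_mulrn ?ltW// -powRrM; congr (_ `^ _).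
  by field.
have rC0 : r%:C != 0 by rewrite -cmod_eq0 cmodE/= expr0n addr0 sqrtr_sqr normr_eq0 gt_eqF.
have uE : z / r%:C * (w / r%:C)^* = z * w^* * (r ^- 2)%:C.
  rewrite rmorphM fmorphV /= [(r%:C)^*]conj_ReIm oppr0 mulrACA -invfM.
  by rewrite -expr2 -rmorphXn -fmorphV.
rewrite corr_kernel_power_family//; first last.
- by rewrite uE; apply: is_argZ => //; rewrite invr_gt0 exprn_gt0.
- by rewrite mulf_neq0// invr_neq0.
- by rewrite mulf_neq0// invr_neq0.
rewrite uE r2 -mulr_sumr.
have -> : N%:R^-1 = (r ^- 2) * (r ^- 2) ^+ d.-1.
  rewrite -exprS (prednK hd) exprVn -exprM mulnC exprM -rd sqr_sqrtr// ltW//.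
rewrite rd.
have E v : (v / r%:C) ^+ d = v ^+ d / (r ^+ d)%:C.
  by rewrite exprMn exprVn rmorphXn.
have kE : (r ^- 2 * r ^- 2 ^+ d.-1)%:C = (r ^- 2)%:C * (r ^- 2)%:C ^+ d.-1.
  by rewrite rmorphM rmorphXn.
under [in RHS]eq_bigr do rewrite -!E.
rewrite kE exprMn; ring.
Qed.

End Kernels.

Theorem proposition1p5 (R : realType) (a c : R) (d N : nat)
    (ha : 0 <= a) (hc : -1 < c) (hd : (1 <= d)%N) (hN : (1 <= N)%N)
    (q : nat -> {poly R[i]})
    (hq : orthonormal_polynomials (V d a) c (d * N) q)
    (p : nat -> nat -> {poly R[i]})
    (hp : forall l : nat, (l < d)%N ->
            orthonormal_polynomials (Q a) ((c + l%:R + 1) / d%:R - 1) N (p l)) :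
  (forall (zeta eta : R[i]) (t : R), zeta != 0 -> eta != 0 ->
     is_arg t (zeta * eta^*) ->
     corr_kernel (V d a) c (d * N) q t zeta eta =
     d%:R * (zeta * eta^*) ^+ d.-1 *
     \sum_(l < d) corr_kernel (Q a) ((c + l%:R + 1) / d%:R - 1) N (p l)
                              (d%:R * t) (zeta ^+ d) (eta ^+ d)) /\
  (forall (z w : R[i]) (t : R), z != 0 -> w != 0 ->
     is_arg t (z * w^*) ->
     rescaled_corr_kernelV d a c (d * N) q t z w =
     d%:R * (z * w^*) ^+ d.-1 *
     \sum_(l < d) rescaled_corr_kernelQ a ((c + l%:R + 1) / d%:R - 1) N (p l)
                                        (d%:R * t) (z ^+ d) (w ^+ d)).
Proof.
have -> : q = power_family d p.
  by apply/funext; exact: orthonormal_polynomials_V_unique hp.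
split => z w t z0 w0 ht.
  exact: (corr_kernel_power_family a c N p hd z0 w0 ht).
exact: (rescaled_corr_kernel_power_family a c p hd hN z0 w0 ht).
Qed.
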